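(* Let $m>2$ be an integer and let $\alpha<1$ be a real number. Then none of the functions $R_{m,0}(x), R_{m,1}(x),\ldots,R_{m,m-1}(x)$ is $o(x^{\alpha})$ as $x\to\infty$; that is, for every $j\in\{0,1,\ldots,m-1\}$ the relation $R_{m,j}(x)=o(x^\alpha)$ fails.
   Context: For a positive integer $n$, $\Omega(n)$ denotes the number of prime divisors of $n$ counted with multiplicity (so $\Omega(1)=0$). For a positive integer $m$, $j\in\{0,1,\ldots,m-1\}$ and real $x$, let $N_{m,j}(x):=\#\{n\leq x:\Omega(n)\equiv j \pmod m\}$, where $n$ ranges over positive integers, and let $R_{m,j}(x):=N_{m,j}(x)-\frac{x}{m}$. *)

(* Defs.v *)
From HB Require Import structures.
From mathcomp Require Import all_boot all_order all_algebra.
From mathcomp Require Import all_classical all_reals all_analysis.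
Set Implicit Arguments.
Unset Strict Implicit.
Unset Printing Implicit Defensive.
Import Order.TTheory GRing.Theory Num.Theory.
Import numFieldNormedType.Exports.
Local Open Scope ring_scope.

Definition prime_Omega (n : nat) : nat := (\sum_(p <- primes n) logn p n)%N.

(* [Num.truncn x] is the floor of [x] when [0 <= x] and [0] otherwise, so the
   index ranges exactly over the positive integers [n] with [n%:R <= x]. *)
Definition Omega_count (R : realType) (m j : nat) (x : R) : nat :=
  (\sum_(1 <= n < (Num.truncn x).+1 | prime_Omega n == j %[mod m]) 1)%N.

Definition Omega_rem (R : realType) (m j : nat) (x : R) : R :=
  (Omega_count m j x)%:R - x / m%:R.

(* Lets the Landau notations, which are keyed on [filter_on], range over +oo. *)
Canonical pinfty_filter_on (R : numFieldType) :=
  FilterType (pinfty_nbhs R) (@proper_pinfty_nbhs R).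

(* Main.v *)
Require Import Defs.
From mathcomp Require Import all_boot all_order all_algebra.
From mathcomp Require Import all_classical all_reals all_analysis.
From mathcomp Require Import ring lra zify.
Import Order.TTheory GRing.Theory Num.Theory.
Import numFieldNormedType.Exports.
Local Open Scope ring_scope.
Local Open Scope classical_set_scope.

(** Why no remainder term is small. Let [z = e^(2 pi i / m)] and, for real [s >
    1], let [F_k(s)] be the sum over [n] of [z ^ (k Omega(n)) n^(-s)], so that
    [F_k(s)] is the Euler product of the factors [1 / (1 - z^k p^(-s))]. Let
    [a(n)] be the sum of the real parts of [z ^ (k (Omega(n) - j))] over [0 < k
    < m]. By orthogonality of the roots of unity ([sum_cos_angle]), [a(n)] is
    [m - 1] or [-1] according as [Omega(n)] is congruent to [j] or not; hence
    its partial sum up to [N] is [m] times the remainder at [N]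
    ([class_coef_sum]), while its Dirichlet series [D(s)] is the sum of the
    real parts of [z^(-jk) F_k(s)].

    If the remainder is [o(x^alpha)] with [alpha < 1], Abel summation shows
    that [D] extends to [s = 1] in a Lipschitz way: [|D(s) - L| <= K (s - 1)]
    for some [L] and [K] ([bounded_partial_sums_lipschitz]). The oscillation of
    [F_1] near [s = 1] contradicts this, as follows.

    Let [P(s)] be the sum of [p^(-s)] over the primes, which tends to infinity
    as [s] decreases to 1 ([prime_sum_large]). The modulus of [F_k(s)] is of
    the order of [exp (cos (2 pi k / m) P(s))], so [F_1] and its conjugate
    [F_(m-1)] dominate the other [F_k]. They also dominate [s - 1], which is of
    the order of [1 / zeta(s)] and so of [exp (- P(s))], because [cos (2 pi /
    m) > -1]: this is where [m > 2] enters ([dominance]). The argument of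
    [F_1(s)] is continuous in [s] and at least a constant times [sin (2 pi / m)
    P(s)], so it turns around the circle infinitely often as [s] tends to 1
    ([phase_hits]). At points close to 1 where [z^(-j) F_1] is positive, [D(s)]
    is nearly twice its modulus, which is much more than [K (s - 1)]: therefore
    [L > 0]. At points where it is negative, in the same way, [L < 0].

    The proof stays with real parts. Multiplying [F] by [e^(i theta)] is
    expressed as a shift of the free phase [beta] in the real part of [e^(i
    beta) F], and the Euler product is obtained by removing the multiples of
    one prime after the other ([euler_sieve]), so that only finite products
    occur. *)

Set Implicit Arguments.
Unset Strict Implicit.

(** * The number of prime factors *)

Lemma prime_OmegaE (n M : nat) : (n < M)%N ->
  prime_Omega n = (\sum_(0 <= p < M) logn p n)%N.
Proof.
move=> nM; rewrite /prime_Omega.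
have [->|n0] := posnP n.
  by rewrite /= big_nil big1 // => i _; rewrite logn0.
rewrite [RHS](bigID (fun p => p \in primes n)) /= [X in (_ + X)%N]big1 ?addn0;
  last first.
  move=> p; rewrite mem_primes lognE n0 /= => /negbTE; case: (prime p) => //=.
  by move=> ->.
rewrite -[RHS]big_filter; apply: perm_big; apply: uniq_perm.
- exact: primes_uniq.
- by rewrite filter_uniq // iota_uniq.
- move=> p; rewrite mem_filter mem_index_iota /=.
  apply/idP/andP => [pn|[]//]; split => //.
  apply: leq_ltn_trans nM; apply: dvdn_leq => //.
  by move: pn; rewrite mem_primes => /and3P[].
Qed.

Lemma prime_OmegaM (p k : nat) : prime p -> (0 < k)%N ->
  prime_Omega (p * k)%N = (prime_Omega k).+1.
Proof.
move=> pp k0; have p0 := prime_gt0 pp.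
rewrite (@prime_OmegaE _ (p * k).+1) // (@prime_OmegaE k (p * k).+1);
  last first.
  by rewrite ltnS leq_pmull.
under eq_bigr do rewrite lognM // logn_prime //.
rewrite big_split /= -[RHS]add1n; congr (_ + _)%N.
have pin : p \in index_iota 0 (p * k).+1
  by rewrite mem_index_iota /= ltnS leq_pmulr.
rewrite (bigD1_seq p) ?iota_uniq //= eqxx.
by rewrite big1 // => i /negbTE ->.
Qed.

(** * Negative powers and Dirichlet series *)

(** The value at [n = 0] is [0] (for [s != 0]), so that every Dirichlet series
    below may be summed from the index 0. *)
Definition npow {R : realType} (s : R) (n : nat) : R := n%:R `^ (- s).

Section negative_powers.
Context {R : realType}.
Implicit Types (s t : R) (n k : nat).

Lemma npow0 s : 0 < s -> npow s 0 = 0.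
Proof. by move=> s0; rewrite /npow powR0 // oppr_eq0 gt_eqF. Qed.

Lemma npow1 s : npow s 1 = 1.
Proof. by rewrite /npow powR1. Qed.

Lemma npow_ge0 s n : 0 <= npow s n.
Proof. exact: powR_ge0. Qed.

Lemma npowM s m n : npow s (m * n)%N = npow s m * npow s n.
Proof. by rewrite /npow natrM powRM. Qed.

Lemma npowE s n : (0 < n)%N -> npow s n = expR (- (s * ln n%:R)).
Proof. by move=> n0; rewrite /npow /powR pnatr_eq0 gtn_eqF // mulNr. Qed.

Lemma npowD s t n : (0 < n)%N -> npow (s + t) n = npow s n * npow t n.
Proof. by move=> n0; rewrite !npowE // -expRD mulrDl opprD. Qed.

Lemma npow_inv n : npow 1 n = n%:R^-1 :> R.
Proof. exact: powR_inv1. Qed.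

Lemma npow_le s t n : 0 < s -> s <= t -> npow t n <= npow s n.
Proof.
move=> s0 st; case: n => [|n]; first by rewrite !npow0 // (lt_le_trans s0).
by rewrite /npow ler_powR ?lerN2 // ler1n.
Qed.

Lemma npow_le_half s n : 1 <= s -> (1 < n)%N -> npow s n <= 2^-1.
Proof.
move=> s1 n1; apply: le_trans (npow_le _ _ s1) _ => //.
by rewrite npow_inv lef_pV2 ?posrE ?ltr0n // ?ler_nat // (ltn_trans _ n1).
Qed.

(** A discrete form of integrating [s * x ^ (- s - 1)] over [k, k + 1]: it
    comes down to [1 + s / (k + 1) <= exp (s / (k + 1)) <= ((k + 1) / k) ^ s].
    *)
Lemma npow_telescope s k : (0 < k)%N -> 0 <= s ->
  s * npow (1 + s) k.+1 <= npow s k - npow s k.+1.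
Proof.
move=> k0 s0; rewrite npowD // npow_inv.
have k0' : (0 : R) < k%:R by rewrite ltr0n.
suff h : npow s k.+1 * (1 + s / k.+1%:R) <= npow s k.
  have -> : s * (k.+1%:R^-1 * npow s k.+1) =
    npow s k.+1 * (1 + s / k.+1%:R) - npow s k.+1 by ring.
  by rewrite lerD2r.
rewrite !npowE //.
apply: (@le_trans _ _ (expR (- (s * ln k.+1%:R)) * expR (s / k.+1%:R))).
  by rewrite ler_pM2l ?expR_gt0 // expR_ge1Dx.
rewrite -expRD ler_expR.
suff h : ln k%:R <= ln k.+1%:R - k.+1%:R^-1 :> R.
  have := ler_wpM2l s0 h; rewrite mulrBr.
  by move: (s * ln _) (s * ln _) (s / _) => a b c; lra.
have -> : (k%:R : R) = k.+1%:R * (1 + (- k.+1%:R^-1)).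
  by rewrite mulrDr mulr1 mulrN divff ?pnatr_eq0 // -natr1 addrK.
have ltk : (-1 : R) < - k.+1%:R^-1.
  by rewrite ltrN2 invf_lt1 ?ltr0n // ltr1n ltnS.
rewrite lnM ?posrE ?ltr0n //; last by rewrite -ltrBlDl sub0r.
by rewrite lerD2l le_ln1Dx.
Qed.

Lemma series_npow_le s N : 1 < s -> series (npow s) N <= 1 + (s - 1)^-1.
Proof.
move=> s1.
suff h : series (npow s) N.+2 <= 1 + (s - 1)^-1 * (1 - npow (s - 1) N.+1).
  apply: le_trans (nondecreasing_series (fun n _ _ => npow_ge0 s n) _) _;
    first exact: (leq_trans (leqnSn N) (leqnSn N.+1)).
  apply: le_trans h _; rewrite lerD2l ger_pMr ?invr_gt0 ?subr_gt0 //.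
  by have := npow_ge0 (s - 1) N.+1; lra.
elim: N => [|N IH].
  by rewrite /series /= big_nat_recr //= big_nat1 npow0 ?npow1; [lra|lra].
rewrite seriesSr; apply: le_trans (lerD IH (lexx _)) _.
have s10 : 0 < s - 1 by lra.
rewrite -addrA lerD2l -lerBrDl -mulrBr ler_pdivlMl //.
have := @npow_telescope (s - 1) N.+1 isT (ltW s10).
have -> : 1 + (s - 1) = s by ring.
by move: (npow (s - 1) _) (npow (s - 1) _) ((s - 1) * _) => a b c; lra.
Qed.

Definition zeta s : R := limn (series (npow s)).

Lemma cvg_zeta s : 1 < s -> cvgn (series (npow s)).
Proof.
move=> s1; apply: nondecreasing_is_cvgn.
  by apply: nondecreasing_series => n _ _; exact: npow_ge0.
by exists (1 + (s - 1)^-1) => _ [N _ <-]; exact: series_npow_le.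
Qed.

Lemma zeta_le s : 1 < s -> zeta s <= 1 + (s - 1)^-1.
Proof.
move=> s1; apply: limr_le; first exact: cvg_zeta.
by apply: nearW => N; exact: series_npow_le.
Qed.

Lemma series_npow_le_zeta s N : 1 < s -> series (npow s) N <= zeta s.
Proof.
move=> s1; apply: nondecreasing_cvgn_le; last exact: cvg_zeta.
by apply: nondecreasing_series => n _ _; exact: npow_ge0.
Qed.

Lemma cvg_dirichlet (c : nat -> R) s : 1 < s -> (forall n, `|c n| <= 1) ->
  cvgn (series (fun n => c n * npow s n)).
Proof.
move=> s1 c1; apply: normed_cvg.
apply: series_le_cvg (cvg_zeta s1) => n /=; rewrite ?normr_ge0 ?npow_ge0 //.
by rewrite normrM (ger0_norm (npow_ge0 _ _)) ler_piMl ?npow_ge0.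
Qed.

(** The bound is the same for all coefficients of modulus at most 1; hence the
    limits over the sieving level taken later are uniform in the phase. *)
Lemma dirichlet_tail (c : nat -> R) s N : 1 < s -> (forall n, `|c n| <= 1) ->
  `|limn (series (fun n => c n * npow s n))
     - series (fun n => c n * npow s n) N| <= zeta s - series (npow s) N.
Proof.
move=> s1 c1.
have cvc := cvg_dirichlet s1 c1.
have cv1 : (fun M => `|series (fun n => c n * npow s n) M
     - series (fun n => c n * npow s n) N|) @ \oo -->
  `|limn (series (fun n => c n * npow s n))
     - series (fun n => c n * npow s n) N|.
  by apply: cvg_norm; apply: cvgB => //; apply: cvg_cst.
have cv2 : (fun M => series (npow s) M - series (npow s) N) @ \oo -->
   zeta s - series (npow s) N.
  by apply: cvgB; [exact: cvg_zeta | apply: cvg_cst].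
apply: (ler_cvg_to cv1 cv2).
exists N => // M /= NM; rewrite !sub_series_geq //.
apply: le_trans (ler_norm_sum _ _ _) _; apply: ler_sum => n _.
by rewrite normrM (ger0_norm (npow_ge0 _ _)) ler_piMl ?npow_ge0.
Qed.

Lemma zeta_tail_cvg0 s : 1 < s ->
  (fun N => zeta s - series (npow s) N) @ \oo --> (0 : R).
Proof.
move=> s1; rewrite -[X in _ --> X](subrr (zeta s)).
by apply: cvgB; [apply: cvg_cst | exact: cvg_zeta].
Qed.

End negative_powers.

Lemma sum_multiples (R : realType) (u : nat -> R) (p M : nat) : (0 < p)%N ->
  series (fun n => (p %| n)%:R * u n) (p * M)%N =
  series (fun k => u (p * k)%N) M.
Proof.
move=> p0; elim: M => [|M IH]; first by rewrite muln0 /series /= !big_geq.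
rewrite seriesSr -IH mulnS series_addn; congr (_ + _).
rewrite big_ltn; last by rewrite -[X in (X < _)%N]add0n ltn_add2r.
rewrite dvdn_mulr // mul1r big_nat_cond big1 ?addr0 // => n.
rewrite andbT => /andP[h1 h2].
suff -> : (p %| n)%N = false by rewrite mul0r.
apply/negP => /dvdnP[q nE]; move: h1 h2; rewrite nE [(q * p)%N]mulnC -mulnS.
by rewrite !ltn_pmul2l // ltnS => h1 h2; move: (leq_trans h1 h2); rewrite ltnn.
Qed.

(** The two sequences of partial sums agree along the multiples of [p]. *)
Lemma cvg_sum_multiples (R : realType) (u : nat -> R) (p : nat) (l : R) :
  (0 < p)%N ->
  series (fun k => u (p * k)%N) @ \oo --> l ->
  cvgn (series (fun n => (p %| n)%:R * u n)) ->
  limn (series (fun n => (p %| n)%:R * u n)) = l.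
Proof.
move=> p0 cl cu.
have h : (series (fun n => (p %| n)%:R * u n) \o (muln p)) @ \oo -->
    limn (series (fun n => (p %| n)%:R * u n)).
  apply: cvg_comp cu.
  move=> A [N _ AN]; exists N => // n /= Nn; apply: AN => /=.
  by apply: leq_trans Nn _; rewrite leq_pmull.
apply: (cvg_unique _ h) => //.
suff -> : series (fun n => (p %| n)%:R * u n) \o muln p = series (fun k =>
  u (p * k)%N) by [].
by apply/funext => M /=; rewrite sum_multiples.
Qed.

(** * The polar form of one Euler factor *)

Section local_factor.
Context {R : realType}.
Implicit Types (phi psi beta x d : R).

(** [euler_modulus] and [euler_arg] are the polar coordinates of an Euler
    factor: [1 / (1 - x e^(i phi))] is [euler_modulus phi x * e^(i euler_arg
    phi x)] for [0 <= x < 1]. *)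
Definition euler_modulus phi x : R :=
  (Num.sqrt ((1 - x * cos phi) ^+ 2 + (x * sin phi) ^+ 2))^-1.
Definition euler_arg phi x : R := atan (x * sin phi / (1 - x * cos phi)).

Lemma one_sub_xcos_gt0 phi x : 0 <= x < 1 -> 0 < 1 - x * cos phi.
Proof.
move=> /andP[x0 x1]; have := cos_le1 phi => c1.
have : x * cos phi <= x * 1 by rewrite ler_wpM2l.
by rewrite mulr1; lra.
Qed.

Lemma euler_norm_gt0 phi x : 0 <= x < 1 ->
  0 < (1 - x * cos phi) ^+ 2 + (x * sin phi) ^+ 2.
Proof.
move=> /(one_sub_xcos_gt0 phi) h.
by rewrite ltr_pwDl ?exprn_gt0 ?sqr_ge0.
Qed.

Lemma euler_modulus_gt0 phi x : 0 <= x < 1 -> 0 < euler_modulus phi x.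
Proof. by move=> x01; rewrite invr_gt0 sqrtr_gt0 euler_norm_gt0. Qed.

(** This is the real part of [e^(i beta) = r e^(i (beta + theta)) (1 - x e^(i
    phi))], where [r e^(i theta) = 1 / (1 - x e^(i phi))].  Keeping [beta] free
    lets an Euler factor act on real parts alone: it scales by [r] and shifts
    [beta]. *)
Lemma euler_factor phi beta x : 0 <= x < 1 ->
  cos beta = euler_modulus phi x *
    (cos (beta + euler_arg phi x) - x * cos (beta + euler_arg phi x + phi)).
Proof.
move=> x01; have := one_sub_xcos_gt0 phi x01; have := euler_norm_gt0 phi x01.
rewrite /euler_modulus /euler_arg.
set a := 1 - x * cos phi; set b := x * sin phi => n0 a0.
set q := Num.sqrt _; set th := atan _.
have q0 : 0 < q by rewrite sqrtr_gt0.
have q2 : q ^+ 2 = a ^+ 2 + b ^+ 2 by rewrite sqr_sqrtr // ltW.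
have an0 : a != 0 by rewrite gt_eqF.
have qn0 : q != 0 by rewrite gt_eqF.
have Cth : q * cos th = a.
  rewrite cos_atan.
  have -> : 1 + (b / a) ^+ 2 = (q / a) ^+ 2 by rewrite !expr_div_n q2; field.
  rewrite sqrtr_sqr ger0_norm; last by rewrite divr_ge0 ?ltW.
  by rewrite invf_div mulrC divfK.
have Sth : q * sin th = b.
  have cn0 : cos th != 0 by apply: contra_neq an0 => c0; rewrite -Cth c0 mulr0.
  have := atanK (b / a); rewrite -/th /tan => tE.
  have -> : sin th = b / a * cos th by rewrite -tE divfK.
  by rewrite mulrCA Cth divfK.
have -> : cos beta = q^-1 * (q * cos beta) by rewrite mulKf.
congr (_ * _).
have e1 : a * cos th + b * sin th = q.
  rewrite -Cth -Sth.
  have -> : q * cos th * cos th + q * sin th * sin th =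
    q * (cos th ^+ 2 + sin th ^+ 2) by ring.
  by rewrite cos2Dsin2 mulr1.
have e2 : a * sin th - b * cos th = 0 by rewrite -Cth -Sth; ring.
rewrite -[LHS](subr0 _) -{1}e1 -(mulr0 (sin beta)) -e2 /a /b !cosD !sinD.
by ring.
Qed.

(** The squared quotient of the two moduli is [1 - 2 x (cos phi - cos psi) / |1
    - x e^(i psi)|^2], and the denominator is at most 3 because [x <= 1/2]. *)
Lemma euler_modulus_cmp phi psi d x : 0 <= x <= 2^-1 -> 0 <= d ->
  cos psi <= cos phi - d ->
  euler_modulus psi x <= expR (- (d / 3) * x) * euler_modulus phi x.
Proof.
move=> /andP[x0 x1] d0 hd.
have x01 : 0 <= x < 1 by apply/andP; split; lra.
have nE t : (1 - x * cos t) ^+ 2 + (x * sin t) ^+ 2 =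
  1 - 2 * x * cos t + x ^+ 2.
  have -> : (1 - x * cos t) ^+ 2 + (x * sin t) ^+ 2 =
    1 - 2 * x * cos t + x ^+ 2 * (cos t ^+ 2 + sin t ^+ 2) by ring.
  by rewrite cos2Dsin2 mulr1.
have := euler_norm_gt0 phi x01; have := euler_norm_gt0 psi x01.
rewrite /euler_modulus !nE => nps nph.
rewrite -ler_pdivrMr ?invr_gt0 ?sqrtr_gt0 // invrK mulrC.
rewrite ler_pdivrMr ?sqrtr_gt0 //.
rewrite -(@ler_pXn2r _ 2) ?nnegrE ?mulr_ge0 ?expR_ge0 ?sqrtr_ge0 //.
rewrite exprMn !sqr_sqrtr ?(ltW nps) ?(ltW nph) // -expRM_natl.
apply: (@le_trans _ _ ((1 + 2 * (- (d / 3) * x)) * (1 - 2 * x * cos psi + x ^+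
  2))); last first.
  by rewrite ler_pM2r // expR_ge1Dx.
have cpsi : - cos psi <= 1 by rewrite lerNl cos_geN1.
have hn : 1 - 2 * x * cos psi + x ^+ 2 <= 3.
  have : x * (- cos psi) <= x * 1 by rewrite ler_wpM2l.
  have : x * x <= x * 2^-1 by rewrite ler_wpM2l.
  by rewrite expr2; lra.
have h1 : x * (cos phi - cos psi) >= x * d by rewrite ler_wpM2l //; lra.
have h2 : (x * d) * (1 - 2 * x * cos psi + x ^+ 2) <= (x * d) * 3.
  by rewrite ler_wpM2l // mulr_ge0.
by rewrite !expr2 in h2 *; lra.
Qed.

(** [1 - x <= 1 / (1 + x)], and the latter is the modulus at the angle [pi]. *)
Lemma euler_modulus_cmp1 phi d x : 0 <= x <= 2^-1 -> 0 <= d ->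
  d <= 1 + cos phi ->
  1 - x <= expR (- (d / 3) * x) * euler_modulus phi x.
Proof.
move=> x01 d0 hd; apply: le_trans (@euler_modulus_cmp phi pi d x x01 d0 _);
  last by rewrite cospi; lra.
have /andP[x0 x1] := x01.
rewrite /euler_modulus cospi sinpi mulr0 expr0n addr0 sqrtr_sqr ger0_norm;
  last by lra.
by rewrite -[leRHS]mul1r ler_pdivlMr; nra.
Qed.

Lemma euler_modulus0_le x : 0 <= x <= 2^-1 -> euler_modulus 0 x <= expR (2 * x).
Proof.
move=> /andP[x0 x1]; rewrite /euler_modulus cos0 sin0 mulr0 mulr1 expr0n addr0.
rewrite sqrtr_sqr ger0_norm; last by lra.
rewrite -[leLHS]mul1r ler_pdivrMr; last by lra.
apply: (@le_trans _ _ ((1 + 2 * x) * (1 - x))); first by nra.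
by rewrite ler_wpM2r ?expR_ge1Dx; lra.
Qed.

Lemma euler_modulus0 x : 0 <= x <= 2^-1 -> euler_modulus 0 x = (1 - x)^-1.
Proof.
move=> /andP[x0 x1]; rewrite /euler_modulus cos0 sin0 mulr0 mulr1 expr0n addr0.
by rewrite sqrtr_sqr ger0_norm //; lra.
Qed.

Lemma euler_arg0 x : euler_arg 0 x = 0.
Proof. by rewrite /euler_arg sin0 mulr0 mul0r atan0. Qed.

Lemma atan_sandwich (y : R) : 0 <= y <= 1 -> y / 2 <= atan y <= y.
Proof.
move=> /andP[y0 y1].
have [->|yn0] := eqVneq y 0; first by rewrite mul0r atan0 lexx.
have yp : 0 < y by rewrite lt_neqAle eq_sym yn0.
have d x : x \in `]0, y[%R -> is_derive x 1 (@atan R) ((1 + x ^+ 2)^-1).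
  by move=> _; exact: is_derive1_atan.
have ct : {within `[0, y], continuous (@atan R)}.
  by apply: continuous_subspaceT => x; exact: continuous_atan.
have [c cy] := MVT yp d ct.
rewrite atan0 !subr0 => ->; move: cy; rewrite in_itv /= => /andP[c0 c1].
rewrite mulrC ler_wpM2r //= ?ler_piMl // ?invf_le1; try nra.
by rewrite lef_pV2 ?posrE; nra.
Qed.

Lemma euler_arg_bounds phi x : 0 <= sin phi -> 0 <= x <= 2^-1 ->
  sin phi / 3 * x <= euler_arg phi x <= 2 * x.
Proof.
move=> s0 /andP[x0 x1].
have x01 : 0 <= x < 1 by apply/andP; split; lra.
have a0 := one_sub_xcos_gt0 phi x01.
have s1 := sin_le1 phi; have c1 := cos_le1 phi; have c2 := cos_geN1 phi.
have ha : 2^-1 <= 1 - x * cos phi.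
  have : x * cos phi <= x * 1 by rewrite ler_wpM2l.
  by lra.
have ha' : 1 - x * cos phi <= 3 / 2.
  have : x * - 1 <= x * cos phi by rewrite ler_wpM2l.
  by lra.
have hs : 0 <= x * sin phi by rewrite mulr_ge0.
have hs' : x * sin phi <= x * 1 by rewrite ler_wpM2l.
have y1 : x * sin phi / (1 - x * cos phi) <= 2 * x.
  by rewrite ler_pdivrMr //; nra.
have y2 : 2 / 3 * (x * sin phi) <= x * sin phi / (1 - x * cos phi).
  by rewrite ler_pdivlMr //; nra.
have /atan_sandwich/andP[] : 0 <= x * sin phi / (1 - x * cos phi) <= 1.
  by apply/andP; split; [rewrite divr_ge0 // ltW|lra].
rewrite -/(euler_arg _ _) => h1 h2; apply/andP; split; lra.
Qed.

End local_factor.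

(** * Sieving by the primes *)

Definition rough (N n : nat) : bool := all (leq N) (primes n).

Lemma roughS (N n : nat) : (0 < n)%N ->
  rough N.+1 n = rough N n && ~~ (prime N && (N %| n)%N).
Proof.
move=> n0; have -> : prime N && (N %| n)%N = (N \in primes n)
  by rewrite mem_primes n0.
rewrite /rough; elim: (primes n) => //= p r ->.
by rewrite ltn_neqAle inE negb_or; case: (N == p); case: (N <= p)%N;
  case: (all _ _); case: (N \in r).
Qed.

Lemma rough0 n : rough 0 n.
Proof. exact/allP. Qed.

Lemma rough_primeM (p k : nat) : prime p -> (0 < k)%N ->
  rough p (p * k)%N = rough p k.
Proof.
move=> pp k0; apply/idP/idP => /allP h; apply/allP => q.
  by move=> qk; apply: h; rewrite primesM ?(prime_gt0 pp) // qk orbT.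
rewrite primesM ?(prime_gt0 pp) // primes_prime // mem_seq1 => /predU1P[-> //|].
exact: h.
Qed.

Lemma rough_lt (N n : nat) : (1 < n < N)%N -> rough N n = false.
Proof.
move=> /andP[n1 nN]; apply/negbTE/allPn; exists (pdiv n).
  by rewrite mem_primes pdiv_prime // pdiv_dvd (ltn_trans _ n1).
by rewrite -ltnNge (leq_ltn_trans _ nN) // pdiv_leq // (ltn_trans _ n1).
Qed.

Section sieve.
Context {R : realType}.
Implicit Types (phi beta s : R).

(** The real part of [e^(i beta) z ^ Omega(n)], where [z = e^(i phi)]. *)
Definition twist phi beta (n : nat) : R :=
  cos (phi * (prime_Omega n)%:R + beta).

(** The real part of [e^(i beta)] times the sum of [z ^ Omega(n) n^(-s)] over
    the [n] that are left after all multiples of the primes below [N] are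
    removed. *)
Definition sifted phi beta s (N : nat) : R :=
  limn (series (fun n => (rough N n)%:R * twist phi beta n * npow s n)).

Lemma sifted_coef_le1 phi beta N n : `|(rough N n)%:R * twist phi beta n| <= 1.
Proof. by rewrite normrM normr_nat; case: rough;
  rewrite ?mul1r ?mul0r ?ler01 ?cos_max. Qed.

Lemma cvg_sifted phi beta s N : 1 < s ->
  cvgn (series (fun n => (rough N n)%:R * twist phi beta n * npow s n)).
Proof. by move=> s1; apply: cvg_dirichlet => // n; exact: sifted_coef_le1. Qed.

Lemma siftedN phi beta s N : 1 < s -> ~~ prime N ->
  sifted phi beta s N.+1 = sifted phi beta s N.
Proof.
move=> s1 /negbTE pN; congr (limn (series _)); apply/funext => -[|n] /=.
  by rewrite npow0 ?mulr0 // (lt_trans ltr01).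
by rewrite roughS // pN andbT.
Qed.

(** Since [Omega (p k) = Omega k + 1], the multiples of [p] contribute the
    whole sifted series again, times [p^(-s)] and with its phase advanced by
    [phi]. *)
Lemma sifted_prime phi beta s p : 1 < s -> prime p ->
  sifted phi beta s p.+1 =
  sifted phi beta s p - npow s p * sifted phi (beta + phi) s p.
Proof.
move=> s1 pp; have s0 : 0 < s by rewrite (lt_trans ltr01).
pose u n := (rough p n)%:R * twist phi beta n * npow s n.
have uM k : u (p * k)%N = npow s p * ((rough p k)%:R * twist phi (beta + phi) k
  * npow s k).
  case: k => [|k]; first by rewrite muln0 /u npow0 // !mulr0.
  rewrite /u rough_primeM // /twist prime_OmegaM // npowM -natr1.
  have -> : phi * ((prime_Omega k.+1)%:R + 1) + beta =
            phi * (prime_Omega k.+1)%:R + (beta + phi) by ring.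
  by ring.
have cs := @cvg_sifted phi (beta + phi) s p s1.
have cM : series (fun k => u (p * k)%N) @ \oo -->
  npow s p * sifted phi (beta + phi) s p.
  have -> : series (fun k => u (p * k)%N) = npow s p *:
     series (fun k => (rough p k)%:R * twist phi (beta + phi) k * npow s k).
    by rewrite -seriesZ; congr series; apply/funext => k; rewrite uM.
  by apply: cvgZr; exact: cs.
have cd : cvgn (series (fun n => (p %| n)%:R * u n)).
  have -> : (fun n => (p %| n)%:R * u n) =
    (fun n => (p %| n)%:R * ((rough p n)%:R * twist phi beta n) * npow s n).
    by apply/funext => n; rewrite /u !mulrA.
  apply: cvg_dirichlet => // n; rewrite normrM normr_nat.
  by case: (p %| n)%N; rewrite ?mul1r ?mul0r ?ler01 ?sifted_coef_le1.
rewrite -(cvg_sum_multiples (prime_gt0 pp) cM cd) /sifted -lim_seriesB //;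
  last exact: cvg_sifted.
congr (limn (series _)); apply/funext => -[|n].
  by rewrite !fctE /= /u !npow0 // !mulr0 subr0.
rewrite !fctE /u roughS // pp /=; case: (p %| _)%N => /=; rewrite ?andbF ?andbT.
  by rewrite mul1r subrr !mul0r.
by rewrite !mul0r subr0.
Qed.

Lemma sifted_factor phi beta s p : 1 < s -> prime p ->
  sifted phi beta s p = euler_modulus phi (npow s p) *
    sifted phi (beta + euler_arg phi (npow s p)) s p.+1.
Proof.
move=> s1 pp; rewrite sifted_prime //.
set x := npow s p; set r := euler_modulus _ _; set th := euler_arg _ _.
have x01 : 0 <= x < 1.
  by rewrite npow_ge0 (le_lt_trans (npow_le_half (ltW s1) (prime_gt1 pp))) //
    invf_lt1 // ltr1n.
have c1 := @cvg_sifted phi (beta + th) s p s1.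
have c2 := @cvg_sifted phi (beta + th + phi) s p s1.
rewrite /sifted -[x * _]/(x *: _) -lim_seriesZ // -lim_seriesB //;
  last exact: is_cvg_seriesZ.
rewrite -[r * _]/(r *: _) -lim_seriesZ; last first.
  by apply: is_cvg_seriesB => //; exact: is_cvg_seriesZ.
congr (limn (series _)); apply/funext => n; rewrite !fctE /= /twist.
rewrite (@euler_factor _ phi _ x x01) -/r -/th !addrA.
rewrite /GRing.scale /=; ring.
Qed.

Definition euler_prod phi s N : R :=
  \prod_(0 <= p < N | prime p) euler_modulus phi (npow s p).
Definition euler_phase phi s N : R :=
  \sum_(0 <= p < N | prime p) euler_arg phi (npow s p).

Lemma euler_prodS phi s N : euler_prod phi s N.+1 =
  euler_prod phi s N * (if prime N then euler_modulus phi (npow s N) else 1).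
Proof. by rewrite /euler_prod big_mkcond big_nat_recr //= -big_mkcond. Qed.

Lemma euler_phaseS phi s N : euler_phase phi s N.+1 =
  euler_phase phi s N + (if prime N then euler_arg phi (npow s N) else 0).
Proof. by rewrite /euler_phase big_mkcond big_nat_recr //= -big_mkcond. Qed.

(** The Euler product in finite form.  The sifted series on the right tends to
    the cosine of its phase, by [sifted_near_cos], so the finite product
    determines the modulus and the argument of the full series up to a small
    error. *)
Lemma euler_sieve phi beta s N : 1 < s ->
  sifted phi beta s 0 =
  euler_prod phi s N * sifted phi (beta + euler_phase phi s N) s N.
Proof.
move=> s1; elim: N => [|N ->].
  by rewrite /euler_prod /euler_phase !big_geq // mul1r addr0.
rewrite euler_prodS euler_phaseS; case: ifP => pN;
  last by rewrite mulr1 addr0 siftedN // pN.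
by rewrite sifted_factor // mulrA addrA.
Qed.

(** The only [n] with [0 < n < N] that survives the sieve is [n = 1]. *)
Lemma sifted_near_cos phi beta s N : 1 < s -> (1 < N)%N ->
  `|sifted phi beta s N - cos beta| <= zeta s - series (npow s) N.
Proof.
move=> s1 N1; have s0 : 0 < s by rewrite (lt_trans ltr01).
apply: le_trans (@dirichlet_tail R (fun n =>
  (rough N n)%:R * twist phi beta n) s N s1 _); last first.
  by move=> n; exact: sifted_coef_le1.
rewrite /sifted; suff -> : series (fun n =>
  (rough N n)%:R * twist phi beta n * npow s n) N = cos beta by [].
rewrite /series /= big_ltn ?(ltn_trans _ N1) // npow0 // mulr0 add0r big_ltn //.
rewrite big_nat_cond big1 => [|n]; last by rewrite andbT => nN;
  rewrite rough_lt // !mul0r.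
by rewrite addr0 npow1 mulr1 /rough /= mul1r /twist /prime_Omega /= big_nil
  mulr0 add0r.
Qed.

End sieve.

(** * Comparison of Euler products near 1 *)

Section dominance.
Context {R : realType}.
Implicit Types (phi psi beta d e s t : R).

Lemma npow_prime_bounds s p : 1 < s -> prime p -> 0 <= npow s p <= 2^-1.
Proof.
by move=> s1 pp; rewrite npow_ge0 npow_le_half ?prime_gt1 // ltW.
Qed.

Definition prime_sum s N : R := \sum_(0 <= p < N | prime p) npow s p.

Lemma euler_prod_gt0 phi s N : 1 < s -> 0 < euler_prod phi s N.
Proof.
move=> s1; apply: prodr_gt0 => p pp; apply: euler_modulus_gt0.
have /andP[-> h] := npow_prime_bounds s1 pp.
by rewrite (le_lt_trans h) // invf_lt1 // ltr1n.
Qed.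

Lemma euler_prod_cmp phi psi d s N : 1 < s -> 0 <= d ->
  cos psi <= cos phi - d ->
  euler_prod psi s N <= expR (- (d / 3) * prime_sum s N) * euler_prod phi s N.
Proof.
move=> s1 d0 hd; rewrite /prime_sum mulr_sumr expR_sum -big_split /=.
apply: ler_prod => p pp; have xb := npow_prime_bounds s1 pp.
by rewrite euler_modulus_cmp // ltW ?invr_gt0 // sqrtr_gt0 euler_norm_gt0 //;
  lra.
Qed.

(** The product on the left is close to [1 / zeta s], hence of the order of [s
    - 1]: this compares [s - 1] with the series of angle [phi]. *)
Lemma euler_prod0_inv phi d s N : 1 < s -> 0 <= d -> d <= 1 + cos phi ->
  (euler_prod 0 s N)^-1 <=
    expR (- (d / 3) * prime_sum s N) * euler_prod phi s N.
Proof.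
move=> s1 d0 hd; rewrite /prime_sum mulr_sumr expR_sum -big_split /= -prodfV.
apply: ler_prod => p pp; have xb := npow_prime_bounds s1 pp.
by rewrite euler_modulus0 // invrK euler_modulus_cmp1 // andbT; lra.
Qed.

Lemma euler_prod0_le s N : 1 < s ->
  euler_prod 0 s N <= expR (2 * prime_sum s N).
Proof.
move=> s1; rewrite /prime_sum mulr_sumr expR_sum.
apply: ler_prod => p pp; have xb := npow_prime_bounds s1 pp.
by rewrite euler_modulus0_le // andbT euler_modulus0 // invr_ge0; lra.
Qed.

Lemma zeta_sifted s : zeta s = sifted 0 0 s 0.
Proof.
congr (limn (series _)); apply/funext => n.
by rewrite rough0 /twist mul0r add0r cos0 !mul1r.
Qed.

Lemma zeta_euler s N : 1 < s -> zeta s = euler_prod 0 s N * sifted 0 0 s N.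
Proof.
move=> s1; rewrite zeta_sifted (@euler_sieve _ 0 0 s N s1).
rewrite /euler_phase big1 ?addr0 // => p _; exact: euler_arg0.
Qed.

(** Uniformity in [phi] and [beta] matters: the lemma is applied to a [beta]
    that itself depends on [N]. *)
Lemma near_sifted s e : 1 < s -> 0 < e ->
  \forall N \near \oo, forall phi beta, `|sifted phi beta s N - cos beta| <= e.
Proof.
move=> s1 e0; near=> N => phi beta.
apply: le_trans (sifted_near_cos _ _ s1 _) _; first by near: N; exists 2%N.
near: N; apply: cvgr_le (zeta_tail_cvg0 s1) _ e0.
Unshelve. all: by end_near. Qed.

Lemma harmonic_npow N : series (@harmonic R) N = series (npow 1) N.+1.
Proof.
rewrite /series /= big_nat_recl //= npow0 // add0r.
by apply: eq_bigr => n _; rewrite npow_inv.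
Qed.

(** Each term satisfies [n^(-s) >= n^(-1) (1 - (s - 1) ln n)], so for [s] close
    to 1 a partial sum of [zeta s] is at least half of the harmonic one. *)
Lemma zeta_large (B : R) :
  exists2 s0, 1 < s0 & forall s, 1 < s < s0 -> B <= zeta s.
Proof.
have [K KB] : exists K, 2 * B <= series (@npow R 1) K.
  have nd : nondecreasing_seq (series (@harmonic R)).
    by apply: nondecreasing_series => n _ _; exact: harmonic_ge0.
  have /cvgryPge/(_ (2 * B))[K _ KB] :=
    nondecreasing_dvgn_lt nd (@dvg_harmonic R).
  by exists K.+1; rewrite -harmonic_npow; apply: KB => /=.
exists (1 + (2 * K.+1%:R)^-1); first by rewrite ltrDl invr_gt0 mulr_gt0.
move=> s /andP[s1 s0]; apply: le_trans (series_npow_le_zeta K s1).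
apply: (@le_trans _ _ (2^-1 * series (@npow R 1) K)); first by lra.
rewrite /series /= mulr_sumr; apply: ler_sum_nat => -[|n] /andP[_ nK].
  by rewrite !npow0 ?mulr0 // (lt_trans ltr01).
have -> : s = (s - 1) + 1 by ring.
rewrite npowD // ler_wpM2r ?npow_ge0 // npowE //.
apply: le_trans (expR_ge1Dx _).
have h1 : ln n.+1%:R <= K.+1%:R :> R.
  apply: le_trans (ltW (ln_sublinear _)) _; rewrite ?ltr0n // ler_nat.
  exact: ltnW (ltn_trans nK (ltnSn K)).
have h0 : 0 <= ln n.+1%:R :> R by rewrite ln_ge0 // ler1n.
have h2 : (s - 1) * ln n.+1%:R <= (2 * K.+1%:R)^-1 * K.+1%:R.
  by apply: ler_pM => //; rewrite ?subr_ge0 ?lerBlDl ltW.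
move: h2; rewrite invfM mulfVK ?pnatr_eq0 //.
by move: ((s - 1) * _) => a; lra.
Qed.

(** For large [N] the Euler product gives [zeta s <= 2 exp (2 * prime_sum s
    N)], so the divergence of [zeta] at 1 forces that of the sum over primes.
    *)
Lemma prime_sum_large (M : R) : exists2 s0, 1 < s0 &
  forall s, 1 < s < s0 -> \forall N \near \oo, M <= prime_sum s N.
Proof.
have [s0 s01 h] := zeta_large (2 * expR (2 * M)).
exists s0 => // s /[dup] ss /andP[s1 _]; have := h _ ss => hz.
have h2 : (0 : R) < 2^-1 by rewrite invr_gt0.
near=> N.
have : `|sifted 0 0 s N - cos 0| <= 2^-1.
  by near: N; apply: filterS (near_sifted s1 h2) => N; apply.
rewrite cos0 ler_norml => /andP[_ hN].
have hN2 : sifted 0 0 s N <= 2 by lra.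
have : 2 * expR (2 * M) <= 2 * expR (2 * prime_sum s N).
  apply: le_trans hz _; rewrite (zeta_euler N s1) mulrC.
  apply: (@le_trans _ _ (2 * euler_prod 0 s N)).
    by rewrite ler_wpM2r // ltW // euler_prod_gt0.
  by rewrite ler_wpM2l // euler_prod0_le.
by rewrite ler_pM2l // ler_expR ler_pM2l.
Unshelve. all: by end_near. Qed.

(** Let [F] be the series of angle [phi].  At a point where [e^(i beta) F] is
    real of sign [sg], its modulus exceeds every series whose angle has a
    smaller cosine, and [s - 1] as well, by an arbitrarily large factor.  All
    of them are compared factor by factor at one sieving level [N], where the
    quotients are at most [exp (- d / 3 * prime_sum s N)].  The hypothesis [d
    <= 1 + cos phi] is what [s - 1] requires: it behaves like a series of angle
    [pi]. *)
Lemma dominance phi d e : 0 < d -> d <= 1 + cos phi -> 0 < e ->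
  exists2 s0, 1 < s0 & forall s, 1 < s < s0 -> forall beta (sg theta : R),
    `|sg| = 1 -> euler_phase phi s @ \oo --> theta ->
    sg * cos (beta + theta) = 1 ->
  [/\ 0 < sg * sifted phi beta s 0,
      s - 1 <= e * (sg * sifted phi beta s 0) &
      forall psi gamma, cos psi <= cos phi - d ->
        `|sifted psi gamma s 0| <= e * (sg * sifted phi beta s 0)].
Proof.
move=> d0 hd e0.
(* Makes the quotients at level [N] at most [e / 8]; the 8 covers the constants
   lost in passing from the series to their finite products. *)
pose M := 3 / d * ln (8 / e).
have d3 : 0 < d / 3 by rewrite divr_gt0.
have HM : expR (- (d / 3) * M) = e / 8.
  have -> : - (d / 3) * M = - ln (8 / e) by rewrite /M; field; rewrite gt_eqF.
  by rewrite expRN lnK ?posrE ?divr_gt0 // invf_div.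
have [s0 s01 hs0] := prime_sum_large M.
exists (Order.min s0 2); first by rewrite lt_min s01 ltr1n.
move=> s /andP[s1]; rewrite lt_min => /andP[ss0 s2] beta sg theta sg1 cth hth.
have : \forall N \near \oo,
  [/\ M <= prime_sum s N,
  `|cos (beta + theta) - cos (beta + euler_phase phi s N)| <= 4^-1 &
  forall psi gamma, `|sifted psi gamma s N - cos gamma| <= 4^-1].
  near=> N; split.
  - by near: N; apply: hs0; rewrite s1.
  - near: N; apply: cvgr_dist_le; last by rewrite invr_gt0.
    apply: continuous_cvg; first exact: continuous_cos.
    by apply: cvgD => //; exact: cvg_cst.
  - by near: N; apply: near_sifted => //; rewrite invr_gt0.
move=> [N _ /(_ N (leqnn N))] [hM hc hsif].
have G0 := euler_prod_gt0 phi N s1.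
set G := euler_prod phi s N in G0.
have hE : expR (- (d / 3) * prime_sum s N) <= e / 8.
  by rewrite -HM ler_expR !mulNr lerN2 ler_pM2l.
have hF : G / 2 <= sg * sifted phi beta s 0.
  rewrite (@euler_sieve _ phi beta s N s1) -/G mulrCA ler_wpM2l ?(ltW G0) //.
  have := hsif phi (beta + euler_phase phi s N).
  set A := sifted _ _ _ _; set c := cos (beta + euler_phase phi s N) in hc *.
  move=> hA.
  have : `|1 - sg * A| <= 2^-1.
    have -> : 1 - sg * A = sg * ((cos (beta + theta) - c) - (A - c)).
      by rewrite -hth; ring.
    rewrite normrM sg1 mul1r.
    by apply: le_trans (ler_normB _ _) _; lra.
  by rewrite ler_norml => /andP[_]; lra.
have F0 : 0 < sg * sifted phi beta s 0 by apply: lt_le_trans hF;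
  rewrite divr_gt0.
split => //.
- have Z0 := euler_prod_gt0 0 N s1.
  have hz : (s - 1) * zeta s <= 2.
    apply: le_trans (ler_wpM2l _ (zeta_le s1)) _; first by rewrite subr_ge0 ltW.
    by rewrite mulrDr mulr1 divff ?subr_eq0 ?gt_eqF //; lra.
  have hA : 2^-1 <= sifted 0 0 s N.
    by have := hsif 0 0; rewrite cos0 ler_norml => /andP[h _]; lra.
  have h1 : s - 1 <= 4 * (euler_prod 0 s N)^-1.
    rewrite ler_pdivlMr //; move: hz; rewrite (zeta_euler N s1).
    have : (s - 1) * euler_prod 0 s N * 2^-1 <=
      (s - 1) * euler_prod 0 s N * sifted 0 0 s N.
      by rewrite ler_wpM2l // mulr_ge0 ?subr_ge0 ?(ltW s1) ?(ltW Z0).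
    by rewrite mulrA; lra.
  have h2 := euler_prod0_inv N s1 (ltW d0) hd.
  have h3 : expR (- (d / 3) * prime_sum s N) * G <= e / 8 * G
    by rewrite ler_wpM2r // ltW.
  have h4 : e * (G / 2) <= e * (sg * sifted phi beta s 0)
    by rewrite ler_wpM2l // ltW.
  rewrite -/G in h2; have h5 := le_trans h2 h3; lra.
- move=> psi gamma hpsi; have P0 := euler_prod_gt0 psi N s1.
  rewrite (@euler_sieve _ psi gamma s N s1) normrM (ger0_norm (ltW P0)).
  have hA : `|sifted psi (gamma + euler_phase psi s N) s N| <= 2.
    rewrite -[X in `|X|](subrK (cos (gamma + euler_phase psi s N))).
    apply: le_trans (ler_normD _ _) _.
    by have := hsif psi (gamma + euler_phase psi s N);
      have := cos_max (gamma + euler_phase psi s N); lra.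
  have h2 := euler_prod_cmp N s1 (ltW d0) hpsi.
  have h3 : expR (- (d / 3) * prime_sum s N) * G <= e / 8 * G
    by rewrite ler_wpM2r // ltW.
  have h4 : e * (G / 2) <= e * (sg * sifted phi beta s 0)
    by rewrite ler_wpM2l // ltW.
  rewrite -/G in h2; have h5 := le_trans h2 h3.
  have h6 := ler_wpM2l (ltW P0) hA.
  have h7 : 0 < e * G by rewrite mulr_gt0.
  by lra.
Unshelve. all: by end_near. Qed.

End dominance.

(** * The phase of the Euler product *)

Section total_phase.
Context {R : realType}.
Implicit Types (phi s t : R).

Lemma euler_phase_series phi s N : euler_phase phi s N =
  series (fun p => if prime p then euler_arg phi (npow s p) else 0) N.
Proof. by rewrite /euler_phase big_mkcond. Qed.

Lemma euler_phase_diff phi s N M : 0 <= sin phi -> 1 < s -> (N <= M)%N ->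
  0 <= euler_phase phi s M - euler_phase phi s N
    <= 2 * (series (npow s) M - series (npow s) N).
Proof.
move=> phi0 s1 NM; rewrite !euler_phase_series !sub_series_geq // mulr_sumr.
have h p : 0 <= (if prime p then euler_arg phi (npow s p) else 0) <=
  2 * npow s p.
  case: ifP => pp; last by rewrite lexx mulr_ge0 ?npow_ge0.
  have xb := npow_prime_bounds s1 pp.
  have /andP[h1 ->] := euler_arg_bounds phi0 xb; rewrite andbT.
  apply: le_trans h1; rewrite mulr_ge0 ?npow_ge0 //; lra.
apply/andP; split; first by apply: sumr_ge0 => p _; have /andP[] := h p.
by apply: ler_sum => p _; have /andP[] := h p.
Qed.

Lemma euler_phase_ge phi s N : 0 <= sin phi -> 1 < s ->
  sin phi / 3 * prime_sum s N <= euler_phase phi s N.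
Proof.
move=> phi0 s1; rewrite mulr_sumr; apply: ler_sum => p pp.
by have /andP[] := euler_arg_bounds phi0 (npow_prime_bounds s1 pp).
Qed.

Lemma cvg_euler_phase phi s : 0 <= sin phi -> 1 < s -> cvgn (euler_phase phi s).
Proof.
move=> phi0 s1; apply: nondecreasing_is_cvgn.
  move=> N M NM; rewrite -subr_ge0.
  by have /andP[] := euler_phase_diff phi0 s1 NM.
exists (2 * zeta s) => _ [N _ <-].
have /andP[_] := euler_phase_diff phi0 s1 (leq0n N).
rewrite {1}/euler_phase [in X in _ - X]/euler_phase [in X in _ - X]big_geq //
  subr0.
rewrite /euler_phase; move=> /le_trans; apply.
by rewrite ler_wpM2l // [series _ 0]/series /= big_geq // subr0
  series_npow_le_zeta.
Qed.

(** The argument of the full series of angle [phi], followed continuously in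
    [s] rather than reduced modulo [2 pi]. *)
Definition phase phi s : R := limn (euler_phase phi s).

Lemma phase_tail phi s N : 0 <= sin phi -> 1 < s ->
  0 <= phase phi s - euler_phase phi s N <= 2 * (zeta s - series (npow s) N).
Proof.
move=> phi0 s1.
have cv1 : (fun M => euler_phase phi s M - euler_phase phi s N) @ \oo -->
    phase phi s - euler_phase phi s N.
  by apply: cvgB; [exact: cvg_euler_phase | exact: cvg_cst].
have cv2 : (fun M => 2 * (series (npow s) M - series (npow s) N)) @ \oo -->
   2 * (zeta s - series (npow s) N).
  by apply: cvgMr; apply: cvgB; [exact: cvg_zeta | exact: cvg_cst].
apply/andP; split.
  apply: (cvgr_to_ge cv1); exists N => // M /= NM.
  by have /andP[] := euler_phase_diff phi0 s1 NM.
apply: (ler_cvg_to cv1 cv2); exists N => // M /= NM.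
by have /andP[] := euler_phase_diff phi0 s1 NM.
Qed.

Lemma zeta_tail_le s t N : 1 < s -> s <= t ->
  zeta t - series (npow t) N <= zeta s - series (npow s) N.
Proof.
move=> s1 st; have t1 : 1 < t by exact: lt_le_trans st.
have cv (u : R) : 1 < u -> (fun M => series (npow u) M - series (npow u) N) @
  \oo -->
    zeta u - series (npow u) N.
  by move=> u1; apply: cvgB; [exact: cvg_zeta | exact: cvg_cst].
apply: (ler_cvg_to (cv _ t1) (cv _ s1)); exists N => // M /= NM.
rewrite !sub_series_geq //; apply: ler_sum => n _.
by rewrite npow_le // (lt_trans ltr01).
Qed.

Lemma continuous_npow n : (0 < n)%N -> continuous (fun s => npow s n).
Proof.
move=> n0 s; have -> : (fun s => npow s n) = (fun s => expR (- (s * ln n%:R))).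
  by apply/funext => t; rewrite npowE.
apply: continuous_comp; last exact: continuous_expR.
by apply: cvgN; apply: cvgMl; exact: cvg_id.
Qed.

Lemma continuous_euler_phase phi N s : 1 < s ->
  {for s, continuous (fun s => euler_phase phi s N)}.
Proof.
move=> s1; elim: N => [|p IH].
  have -> : (fun s => euler_phase phi s 0) = cst 0; last exact: cvg_cst.
  by apply/funext => t; rewrite /euler_phase big_geq.
have -> : (fun s => euler_phase phi s p.+1) = (fun s => euler_phase phi s p +
    (if prime p then euler_arg phi (npow s p) else 0)).
  by apply/funext => t; rewrite euler_phaseS.
apply: cvgD => //; case: ifP => pp; last exact: cvg_cst.
rewrite /euler_arg; apply: continuous_cvg; first exact: continuous_atan.
have cx := @continuous_npow p (prime_gt0 pp) s.
apply: cvgM; first by apply: cvgMl.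
apply: cvgV.
  have /andP[h0 h1] := npow_prime_bounds s1 pp.
  rewrite gt_eqF // one_sub_xcos_gt0 // h0 (le_lt_trans h1) //.
  by rewrite invf_lt1 // ltr1n.
by apply: cvgB; [exact: cvg_cst | apply: cvgMl].
Qed.

(** The finite phases converge uniformly on every half-line to the right of 1.
    *)
Lemma continuous_phase phi s : 0 <= sin phi -> 1 < s ->
  {for s, continuous (phase phi)}.
Proof.
move=> phi0 s1; apply/cvgrPdist_le => e e0.
pose s2 := (1 + s) / 2.
have s21 : 1 < s2 by rewrite /s2; lra.
have s2s : s2 < s by rewrite /s2; lra.
have e6 : 0 < e / 6 by rewrite divr_gt0.
have [N _ /(_ N (leqnn N)) hN] :
    \forall N \near \oo, zeta s2 - series (npow s2) N <= e / 6.
  by apply: cvgr_le (zeta_tail_cvg0 s21) _ e6.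
have e3 : 0 < e / 3 by rewrite divr_gt0.
have /cvgrPdist_le/(_ _ e3) := @continuous_euler_phase phi N s s1.
have h t : s2 <= t -> `|phase phi t - euler_phase phi t N| <= e / 3.
  move=> s2t; have t1 : 1 < t by exact: lt_le_trans s2t.
  have /andP[h0 h1] := phase_tail N phi0 t1.
  rewrite ger0_norm //; have := zeta_tail_le N s21 s2t; lra.
move=> cN; near=> t.
have ht : s2 <= t by apply: ltW; near: t; exact: lt_nbhsr.
have hs := h _ (ltW s2s); have := h _ ht.
have h3 : `|euler_phase phi s N - euler_phase phi t N| <= e / 3 by near: t;
  exact: cN.
move: hs h3; rewrite !ler_norml; lra.
Unshelve. all: by end_near. Qed.

Lemma phase_large phi (T : R) : 0 < sin phi -> exists2 s0, 1 < s0 &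
  forall s, 1 < s < s0 -> T <= phase phi s.
Proof.
move=> phi0; have [s0 s01 h] := prime_sum_large (T * 3 / sin phi).
exists s0 => // s ss; have s1 : 1 < s by have /andP[] := ss.
have [N _ /(_ N (leqnn N)) hN] := h s ss.
have /andP[h0 _] := phase_tail N (ltW phi0) s1.
have h1 := euler_phase_ge N (ltW phi0) s1.
have : sin phi / 3 * (T * 3 / sin phi) <= sin phi / 3 * prime_sum s N.
  by rewrite ler_wpM2l // divr_ge0 // ltW.
have -> : sin phi / 3 * (T * 3 / sin phi) = T by field; rewrite gt_eqF.
by lra.
Qed.

Lemma cosD2piM (x : R) n : cos (x + n%:R * (2 * pi)) = cos x.
Proof. by rewrite !mulr_natl (periodicn (@cosD2pi R)). Qed.

(** The phase is continuous and unbounded as [s] decreases to 1, so it crosses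
    [2 pi n - beta] for every large [n]. *)
Lemma phase_hits phi beta s0 : 0 < sin phi -> 1 < s0 ->
  exists2 s, 1 < s < s0 & cos (beta + phase phi s) = 1.
Proof.
move=> phi0 s01; pose s1 := (1 + s0) / 2.
have s11 : 1 < s1 by rewrite /s1; lra.
have s10 : s1 < s0 by rewrite /s1; lra.
have pi2 : 0 < 2 * (pi : R) by rewrite mulr_gt0 // pi_gt0.
pose n := Num.truncn (`|phase phi s1 + beta| / (2 * pi)).
pose v := n.+1%:R * (2 * pi) - beta.
have v1 : phase phi s1 <= v.
  rewrite lerBrDr; apply: le_trans (ler_norm _) _.
  by rewrite -ler_pdivrMr // ltW // truncnS_gt.
have [s3 s31 h3] := phase_large v phi0.
pose s2 := Order.min ((1 + s3) / 2) s1.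
have s21 : 1 < s2 by rewrite lt_min s11 andbT; lra.
have s2s1 : s2 <= s1 by rewrite ge_min lexx orbT.
have v2 : v <= phase phi s2.
  by apply: h3; rewrite s21 gt_min; apply/orP; left; lra.
have ct : {within `[s2, s1], continuous (phase phi)}.
  apply: continuous_in_subspaceT => x; rewrite inE /= in_itv /= => /andP[x2 _].
  by apply: continuous_phase; [exact: ltW | exact: lt_le_trans x2].
have [|c] := IVT s2s1 ct (v := v).
  by rewrite ge_min le_max v1 v2 orbT.
rewrite in_itv /= => /andP[c2 c1] cv; exists c.
  by rewrite (lt_le_trans s21 c2) (le_lt_trans c1 s10).
by rewrite cv /v addrC subrK -[X in cos X]add0r cosD2piM cos0.
Qed.

End total_phase.

(** * Abel summation *)

Section abel.
Context {R : realType}.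
Implicit Types (s t : R).

Lemma abel_sum (a x : nat -> R) N :
  \sum_(1 <= n < N.+1) a n * x n =
  (\sum_(1 <= k < N.+1) a k) * x N.+1 +
  \sum_(1 <= n < N.+1) (\sum_(1 <= k < n.+1) a k) * (x n - x n.+1).
Proof.
elim: N => [|N IH]; first by rewrite !big_geq // mul0r addr0.
rewrite big_nat_recr //= [X in _ = X * _ + _]big_nat_recr //=.
rewrite [X in _ = _ + X]big_nat_recr //= IH [X in _ =
  _ + (_ + X * _)]big_nat_recr //=.
by ring.
Qed.

(** With [s = 1 + e] both [1 - n^(-e)] and [n^(-e) - (n + 1)^(-e)] are of order
    [e], up to the factors [ln n] and [1 / n]. *)
Lemma npow_diff_bounds s n : 1 <= s -> (0 < n)%N ->
  `|(npow s n - npow s n.+1) - (npow 1 n - npow 1 n.+1)|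
    <= (s - 1) * ((1 + ln n%:R) * npow 2 n).
Proof.
move=> s1 n0.
have [e [e0 ->]] : exists e : R, 0 <= e /\ s = 1 + e.
  by exists (s - 1); rewrite subr_ge0; split => //; ring.
have -> : 1 + e - 1 = e by ring.
have n0' : (0 : R) < n%:R by rewrite ltr0n.
have n1' : (0 : R) < n.+1%:R by rewrite ltr0n.
rewrite !npowD // !npow_inv.
have p1 : npow e n <= 1 by rewrite npowE // expR_le1 oppr_le0 mulr_ge0 //
  ln_ge0 // ler1n.
have p2 : 1 - e * ln n%:R <= npow e n by rewrite npowE // expR_ge1Dx.
have p3 : npow e n.+1 <= npow e n.
  by rewrite !npowE // ler_expR lerN2 ler_wpM2l // ler_ln ?posrE // ler_nat.
have p4 : npow e n - npow e n.+1 <= e * n%:R^-1.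
  have -> : npow e n.+1 = npow e n * expR (- (e * (ln n.+1%:R - ln n%:R))).
    by rewrite !npowE // -expRD; congr expR; ring.
  have h1 : 1 - e * n%:R^-1 <= expR (- (e * (ln n.+1%:R - ln n%:R))).
    apply: le_trans (expR_ge1Dx _); rewrite lerD2l lerN2 ler_wpM2l //.
    rewrite -ln_div ?posrE //.
    have -> : n.+1%:R / n%:R = 1 + n%:R^-1 :> R.
      by rewrite -natr1 mulrDl divff ?gt_eqF // mul1r.
    apply: le_ln1Dx; rewrite (lt_trans (ltrN10 _)) // invr_gt0 //.
  have h2 : 0 <= npow e n by exact: npow_ge0.
  have h3 : 0 <= e * n%:R^-1 by rewrite mulr_ge0 // invr_ge0 ltW.
  have h4 := ler_wpM2l h2 h1; have h5 := ler_wpM2r h3 p1.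
  rewrite mulrBr mulr1 in h4; rewrite mul1r in h5.
  by apply: le_trans h5; rewrite lerBlDr -lerBlDl.
have a0 : 0 < n%:R^-1 :> R by rewrite invr_gt0.
have b0 : 0 < n.+1%:R^-1 :> R by rewrite invr_gt0.
have ba : n.+1%:R^-1 <= n%:R^-1 :> R by rewrite lef_pV2 ?posrE // ler_nat.
have q1 : n%:R^-1 - n.+1%:R^-1 = n%:R^-1 * n.+1%:R^-1 :> R.
  by rewrite -natr1; field; apply/andP; split; rewrite ?natr1 gt_eqF.
have L0 : 0 <= ln n%:R :> R by rewrite ln_ge0 // ler1n.
move: (npow e n) (npow e n.+1) (ln n%:R) (n%:R^-1) (n.+1%:R^-1) a0 b0 ba q1 L0
  p1 p2 p3 p4
  => A B L a b a0 b0 ba q1 L0 p1 p2 p3 p4.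
(* Separates the variation of [1 / x] from that of [x ^ (- e)]. *)
have -> : a * A - b * B - (a - b) = b * (A - B) - (a * b) * (1 - A)
  by rewrite -q1; ring.
have h1 : 0 <= b * (A - B) by rewrite mulr_ge0 ?subr_ge0 // ltW.
have h2 : 0 <= a * b * (1 - A) by rewrite !mulr_ge0 ?subr_ge0 // ltW.
have h3 : b * (A - B) <= b * (e * a) by rewrite ler_wpM2l // ltW.
have h4 : a * b * (1 - A) <= a * b * (e * L).
  by rewrite ler_wpM2l ?mulr_ge0 ?(ltW a0) ?(ltW b0) //; lra.
have h5 : e * ((1 + L) * a) * b <= e * ((1 + L) * a) * a.
  by rewrite ler_wpM2l // !mulr_ge0 ?(ltW a0) //; lra.
rewrite ler_norml; apply/andP; split; lra.
Qed.

(** [ln n <= n ^ d / d], so the logarithm costs an arbitrarily small part [d]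
    of the exponent. *)
Lemma cvg_log_npow t : 1 < t ->
  cvgn (series (fun n => (1 + ln n%:R) * npow t n)).
Proof.
move=> t1; pose d := (t - 1) / 2.
have d0 : 0 < d by rewrite /d; lra.
have td : 1 < t - d by rewrite /d; lra.
have t0 : 0 < t by rewrite (lt_trans ltr01).
have cz : cvgn (series (fun n => (1 + d^-1) * npow (t - d) n)).
  exact: is_cvg_seriesZ (cvg_zeta td).
apply: series_le_cvg cz => n.
- case: n => [|n]; first by rewrite npow0 ?mulr0.
  by rewrite mulr_ge0 ?npow_ge0 // addr_ge0 // ln_ge0 // ler1n.
- by rewrite /= mulr_ge0 ?npow_ge0 // addr_ge0 // invr_ge0 ltW.
- case: n => [|n]; first by rewrite npow0 ?mulr0 // mulr_ge0 ?npow_ge0 //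
  addr_ge0 // invr_ge0 ltW.
  have -> : t = (t - d) + d by ring.
  rewrite npowD // addrK mulrCA mulrC ler_wpM2r ?npow_ge0 //.
  have L0 : 0 <= ln n.+1%:R :> R by rewrite ln_ge0 // ler1n.
  have hd : d * ln n.+1%:R <= expR (d * ln n.+1%:R).
    by have := expR_ge1Dx (d * ln n.+1%:R); lra.
  have i1 : npow d n.+1 <= 1 by rewrite npowE // expR_le1 oppr_le0 mulr_ge0 //
    ltW.
  have i2 : ln n.+1%:R * npow d n.+1 <= d^-1.
    rewrite npowE // expRN ler_pdivrMr ?expR_gt0 // ler_pdivlMl //.
  by rewrite mulrDl mul1r lerD.
Qed.

Lemma npow_cvg0 t : 0 < t -> npow t n @[n --> \oo] --> 0.
Proof.
move=> t0; apply/cvgrPdist_le => e e0; near=> n.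
have n0 : (0 < n)%N by near: n; exists 1%N.
rewrite sub0r normrN ger0_norm ?npow_ge0 // npowE // -[leRHS]lnK ?posrE //
  ler_expR.
rewrite lerNl -ler_pdivrMl // -ler_expR lnK ?posrE ?ltr0n //.
by near: n; exact: nbhs_infty_ger.
Unshelve. all: by end_near. Qed.

(** Abel summation rewrites the series in terms of the partial sums of [a] and
    the differences [n^(-s) - (n + 1)^(-s)]; in that form it converges
    absolutely at [s = 1] as well, where its value is [L]. *)
Lemma bounded_partial_sums_lipschitz (a : nat -> R) (alpha C : R) :
  0 <= alpha < 1 -> 0 <= C ->
  (forall n, `|\sum_(1 <= k < n.+1) a k| <= C * n%:R `^ alpha) ->
  exists L K, 0 <= K /\ forall s, 1 < s ->
    cvgn (series (fun n => a n * npow s n)) ->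
    `|limn (series (fun n => a n * npow s n)) - L| <= K * (s - 1).
Proof.
move=> /andP[al0 al1] C0 hS.
pose S n := \sum_(1 <= k < n.+1) a k.
have S0 : S 0%N = 0 by rewrite /S big_geq.
pose b n := S n * (npow 1 n - npow 1 n.+1).
pose w n : R := (1 + ln n%:R) * npow (2 - alpha) n.
have cw : cvgn (series w) by apply: cvg_log_npow; lra.
have w_ge0 n : 0 <= w n.
  case: n => [|n]; first by rewrite /w npow0 ?mulr0 //; lra.
  by rewrite /w mulr_ge0 ?npow_ge0 // addr_ge0 // ln_ge0 // ler1n.
have powE n : n%:R `^ alpha = npow (- alpha) n by rewrite /npow opprK.
have S_le n x y : (0 < n)%N -> 0 <= x ->
  `|y| <= x * ((1 + ln n%:R) * npow 2 n) ->
    `|S n * y| <= x * (C * w n).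
  move=> n0 x0 hy; rewrite normrM.
  apply: le_trans (ler_pM _ _ (hS n) hy) _ => //.
  rewrite powE /w (npowD 2 (- alpha)) //.
  by rewrite le_eqVlt; apply/orP; left; apply/eqP; ring.
have b_le n : `|b n| <= C * w n.
  case: n => [|n]; first by rewrite /b S0 mul0r normr0 mulr_ge0.
  rewrite -[leRHS]mul1r; apply: S_le => //; rewrite mul1r.
  have h1 : npow 1 n.+1 - npow 1 n.+2 <= npow 2 n.+1 :> R.
    have -> : (2 : R) = 1 + 1 by [].
    rewrite npowD // !npow_inv.
    have i1 : 0 < n.+1%:R^-1 :> R by rewrite invr_gt0.
    have i2 : 0 < n.+2%:R^-1 :> R by rewrite invr_gt0.
    have i3 : n.+2%:R^-1 <= n.+1%:R^-1 :> R
      by rewrite lef_pV2 ?posrE // ler_nat.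
    have -> : n.+1%:R^-1 - n.+2%:R^-1 = n.+1%:R^-1 * n.+2%:R^-1 :> R.
      by rewrite -[n.+2%:R]natr1; field; apply/andP; split;
        rewrite ?natr1 gt_eqF.
    by rewrite ler_wpM2l // ltW.
  rewrite ger0_norm ?subr_ge0 ?npow_le //; last first.
    by rewrite !npow_inv lef_pV2 ?posrE // ler_nat.
  apply: le_trans h1 _; rewrite ler_peMl ?npow_ge0 // lerDl ln_ge0 // ler1n //.
have cb : cvgn (series b).
  apply: normed_cvg; have := is_cvg_seriesZ (k := C) cw.
  by apply: series_le_cvg => n //=; rewrite mulr_ge0.
exists (limn (series b)), (C * limn (series w)); split.
  by rewrite mulr_ge0 // limr_ge //; apply: nearW => N; exact: sumr_ge0.
move=> s s1 cD; set u := fun n => a n * npow s n.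
have s0 : 0 < s by rewrite (lt_trans ltr01).
have cv1 : (fun N => `|series u N.+1 - series b N.+1|) @ \oo -->
    `|limn (series u) - limn (series b)|.
  by apply: cvg_norm; apply: cvgB; rewrite cvg_shiftS.
have cv2 : (fun N => C * npow (s - alpha) N + C * limn (series w) * (s - 1)) @
  \oo -->
    C * limn (series w) * (s - 1).
  rewrite -[X in _ --> X]add0r; apply: cvgD; last exact: cvg_cst.
  by rewrite -(mulr0 C); apply: cvgMr; apply: npow_cvg0; lra.
apply: (ler_cvg_to cv1 cv2); exists 1%N => // N /= N0.
have -> : series u N.+1 = S N * npow s N.+1 + \sum_(1 <=
  n < N.+1) S n * (npow s n - npow s n.+1).
  by rewrite /series /= big_ltn // {1}/u npow0 // mulr0 add0r abel_sum.
have -> : series b N.+1 = \sum_(1 <= n < N.+1) b n.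
  by rewrite /series /= big_ltn // /b S0 mul0r add0r.
rewrite -addrA -sumrB; apply: le_trans (ler_normD _ _) _; apply: lerD.
  rewrite normrM (ger0_norm (npow_ge0 _ _)).
  apply: (@le_trans _ _ (C * npow (- alpha) N * npow s N)).
    rewrite -powE; apply: ler_pM; rewrite ?npow_ge0 ?hS //.
    by rewrite !npowE // ler_expR lerN2 ler_wpM2l ?(ltW s0) // ler_ln ?posrE
      ?ltr0n // ler_nat.
  by rewrite -mulrA -npowD // addrC.
apply: le_trans (ler_norm_sum _ _ _) _.
apply: (@le_trans _ _ (\sum_(1 <= n < N.+1) (s - 1) * (C * w n))).
  apply: ler_sum_nat => n /andP[n0 _]; rewrite /b -mulrBr; apply: S_le => //.
    by rewrite subr_ge0 ltW.
  by apply: npow_diff_bounds => //; exact: ltW.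
rewrite -mulr_sumr mulrC ler_wpM2r ?subr_ge0 ?(ltW s1) // -mulr_sumr ler_wpM2l
  //.
apply: (@le_trans _ _ (series w N.+1)).
  by rewrite /series /= [leRHS]big_ltn // lerDr.
apply: nondecreasing_cvgn_le => //; exact: nondecreasing_series.
Qed.

End abel.

(** * Detecting a residue class with cosines *)

Section residue_classes.
Context {R : realType}.

Definition root_angle m : R := 2 * pi / m%:R.

Lemma root_angle_bounds m : (2 < m)%N -> 0 < root_angle m < pi.
Proof.
move=> m2; have m0 : (0 : R) < m%:R by rewrite ltr0n; lia.
have p0 : 0 < (pi : R) by exact: pi_gt0.
rewrite /root_angle; apply/andP; split; first by rewrite divr_gt0 // mulr_gt0.
by rewrite ltr_pdivrMr // mulrC ltr_pM2l // ltr_nat.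
Qed.

(** The angles of index [k] and [m - k] are conjugate. *)
Lemma cos_angleC m (k t : nat) : (0 < m)%N -> (k <= m)%N ->
  cos ((m - k)%:R * root_angle m * t%:R) = cos (k%:R * root_angle m * t%:R).
Proof.
move=> m0 km; have mn0 : (m%:R : R) != 0 by rewrite pnatr_eq0; lia.
have -> : (m - k)%:R * root_angle m * t%:R =
    - (k%:R * root_angle m * t%:R) + t%:R * (2 * pi).
  by rewrite natrB // /root_angle; field.
by rewrite cosD2piM cosN.
Qed.

Lemma sinD2piM (x : R) n : sin (x + n%:R * (2 * pi)) = sin x.
Proof. by rewrite !mulr_natl (periodicn (@sinD2pi R)). Qed.

Lemma sum_cos_angle m (t : nat) : (0 < m)%N ->
  \sum_(0 <= k < m) cos (k%:R * root_angle m * t%:R) =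
  (if (m %| t)%N then m%:R else 0).
Proof.
move=> m0; have mn0 : (m%:R : R) != 0 by rewrite pnatr_eq0; lia.
case: ifPn => [/dvdnP[q ->]|mt].
  rewrite (eq_bigr (fun=> 1)) => [|k _]; first by rewrite sumr_const_nat subn0.
  have -> : k%:R * root_angle m * (q * m)%:R = 0 + (k * q)%:R * (2 * pi).
    by rewrite !natrM /root_angle; field.
  by rewrite cosD2piM cos0.
(* Half the step of the progression of angles; multiplying by [sin h] makes the
   sum telescope, since [2 sin h cos (2 k h)] is the difference of the sines of
   [(2 k + 1) h] and [(2 k - 1) h]. *)
pose h : R := pi * t%:R / m%:R.
have sh : sin h != 0.
  pose r := (t %% m)%N; have r0 : (0 < r)%N by rewrite lt0n.
  have -> : h = pi * r%:R / m%:R + pi *+ (t %/ m).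
    by rewrite /h {1}(divn_eq t m) natrD natrM -(mulr_natr pi); field.
  rewrite (alternatingn (@sinDpi R)) mulf_neq0 ?signr_eq0 // gt_eqF //.
  apply: sin_gt0_pi; rewrite divr_gt0 ?mulr_gt0 ?pi_gt0 ?ltr0n //=.
  by rewrite ltr_pdivrMr ?ltr0n // ltr_pM2l ?pi_gt0 // ltr_nat ltn_mod.
apply: (mulfI sh); rewrite mulr0.
have tel N : sin h * (\sum_(0 <= k < N) cos (k%:R * root_angle m * t%:R)) =
    (sin (N%:R * root_angle m * t%:R - h) + sin h) / 2.
  elim: N => [|N IH]; first by rewrite big_geq // mulr0 !mul0r sub0r sinN addNr
    mul0r.
  rewrite big_nat_recr //= mulrDr IH.
  have -> : N.+1%:R * root_angle m * t%:R - h = N%:R * root_angle m * t%:R + h.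
    by rewrite -natr1 /root_angle /h; field.
  by rewrite sinB sinD; field.
rewrite tel.
have -> : m%:R * root_angle m * t%:R - h = - h + t%:R * (2 * pi).
  by rewrite /root_angle /h; field.
by rewrite sinD2piM sinN addNr mul0r.
Qed.

(** By conjugation [k] may be taken at most [m / 2], and the cosine decreases
    on [0, pi]. *)
Lemma cos_angle_lt m k : (1 < k)%N -> (k.+1 < m)%N ->
  cos (k%:R * root_angle m) < cos (root_angle m) :> R.
Proof.
move=> k1 km; have m0 : (0 : R) < m%:R by rewrite ltr0n; lia.
have /andP[a0 a1] := @root_angle_bounds m ltac:(lia).
wlog kh : k k1 km / (2 * k <= m)%N => [hw|].
  have [|kh] := leqP (2 * k) m; first exact: hw.
  have := @cos_angleC m k 1 ltac:(lia) ltac:(lia).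
  rewrite !mulr1 => <-; apply: hw; lia.
have kp : k%:R * root_angle m <= pi :> R.
  rewrite /root_angle mulrA ler_pdivrMr // mulrA [leRHS]mulrC ler_pM2r ?pi_gt0
    //.
  by rewrite -natrM ler_nat mulnC.
have lt1 : root_angle m < k%:R * root_angle m :> R by rewrite ltr_pMl // ltr1n.
by rewrite ltr_cos // in_itv /=; apply/andP; split; lra.
Qed.

Lemma uniform_gap (g : nat -> R) (d0 : R) (r : seq nat) : 0 < d0 ->
  (forall k, k \in r -> 0 < g k) ->
  exists d, [/\ 0 < d, d <= d0 & forall k, k \in r -> d <= g k].
Proof.
move=> d00; elim: r => [|k r IH] hg; first by exists d0.
have [|d [dp dd0 hd]] := IH; first by move=> i ir; apply: hg;
  rewrite inE ir orbT.
exists (Order.min d (g k)); split.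
- by rewrite lt_min dp hg // inE eqxx.
- by rewrite ge_min dd0.
- by move=> i; rewrite inE ge_min => /predU1P[->|/hd ->//]; rewrite lexx orbT.
Qed.

Lemma cvg_series_sum (f : nat -> nat -> R) (r : seq nat) :
  (forall k, cvgn (series (f k))) ->
  series (fun n => \sum_(k <- r) f k n) @ \oo -->
  \sum_(k <- r) limn (series (f k)).
Proof.
move=> cf; elim: r => [|k r IH].
  have -> : series (fun n => \sum_(k <- [::]) f k n) = cst 0.
    by apply/funext => N; rewrite /series /= big1 // => n _; rewrite big_nil.
  by rewrite big_nil; exact: cvg_cst.
have -> : series (fun n => \sum_(k <- k :: r) f k n) =
  series (f k) + series (fun n => \sum_(k <- r) f k n).
  by rewrite -seriesD; congr series; apply/funext => n; rewrite big_cons.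
by rewrite big_cons; apply: cvgD => //; exact: cf.
Qed.

(** The contribution of the nontrivial [m]-th roots of unity to [m] times the
    indicator of the class of [j].  The shift by [m - j] stands for a rotation
    by [- j], with an exponent that stays a natural number. *)
Definition class_coef m j (n : nat) : R :=
  \sum_(1 <= k < m)
    twist (k%:R * root_angle m) (k%:R * root_angle m * (m - j)%:R) n.

Lemma twist_angle m j k n :
  twist (k%:R * root_angle m) (k%:R * root_angle m * (m - j)%:R) n =
  cos (k%:R * root_angle m * (prime_Omega n + (m - j))%:R).
Proof. by rewrite /twist natrD mulrDr. Qed.

Lemma class_coefE m j n : (j < m)%N ->
  class_coef m j n = m%:R * (prime_Omega n == j %[mod m])%:R - 1.
Proof.
move=> jm; have m0 : (0 < m)%N by lia.
have := sum_cos_angle (prime_Omega n + (m - j)) m0.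
rewrite big_ltn // !mul0r cos0 /class_coef.
under [in X in _ -> X]eq_bigr do rewrite twist_angle.
have -> : (m %| prime_Omega n + (m - j))%N = (prime_Omega n == j %[mod m]).
  rewrite -[(_ == _)](eqn_modDr (m - j)) subnKC ?(ltnW jm) // modnn.
  by rewrite /dvdn.
move=> h; apply: (addrI 1); rewrite h.
by case: (_ == _) => /=; rewrite ?mulr1 ?mulr0; ring.
Qed.

Lemma class_coef_sum m j N : (j < m)%N ->
  \sum_(1 <= n < N.+1) class_coef m j n = m%:R * Omega_rem m j (N%:R : R).
Proof.
move=> jm; have mn0 : (m%:R : R) != 0 by rewrite pnatr_eq0; lia.
under eq_bigr do rewrite class_coefE //.
rewrite sumrB sumr_const_nat subn1 /= /Omega_rem /Omega_count natrK.
rewrite -mulr_sumr natr_sum [in RHS]big_mkcond /= mulrBr mulrC [in X in _ =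
  X - _]mulrC.
congr (_ * _ - _); last by rewrite mulrC divfK.
by apply: eq_bigr => n _; case: ifP.
Qed.

Lemma class_coef_le m j n : (j < m)%N -> `|class_coef m j n| <= m%:R.
Proof.
move=> jm; have m1 : 1 <= m%:R :> R by rewrite ler1n; lia.
by rewrite class_coefE //; case: (_ == _); rewrite ?mulr1 ?mulr0 ler_norml; lra.
Qed.

End residue_classes.

(** * The remainder terms *)

Section remainder_bound.
Context {R : realType}.

(** The Landau relation controls the large arguments only; the constant [C]
    absorbs the others.  Replacing [alpha] by [max alpha 0] keeps the power of
    [N] at least 1 there. *)
Lemma class_coef_sum_le m j (alpha : R) : (j < m)%N -> alpha < 1 ->
  Omega_rem m j =o_ (pinfty_nbhs R) (fun x : R => x `^ alpha) ->
  exists C al : R, [/\ 0 <= C, 0 <= al < 1 &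
    forall N, `|\sum_(1 <= n < N.+1) class_coef m j n| <= C * N%:R `^ al].
Proof.
move=> jm al1 /eqoP/(_ _ ltr01)[A [_ HA]].
exists (m%:R * (1 + `|A|)), (Num.max alpha 0); split.
- by rewrite mulr_ge0 // addr_ge0.
- by rewrite le_max lexx orbT /= gt_max al1 ltr01.
case=> [|N].
  by rewrite big_geq // normr0 mulr_ge0 ?powR_ge0 // mulr_ge0 // addr_ge0.
have N1 : 1 <= N.+1%:R :> R by rewrite ler1n.
have [AN|NA] := ltP A N.+1%:R.
  rewrite class_coef_sum // normrM normr_nat -mulrA ler_wpM2l //.
  have /= := HA _ AN; rewrite mul1r (ger0_norm (powR_ge0 _ _)) => /le_trans;
    apply.
  apply: (@le_trans _ _ (N.+1%:R `^ (Num.max alpha 0))).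
    by rewrite ler_powR // le_max lexx.
  by rewrite ler_peMl ?powR_ge0 // lerDl.
apply: le_trans (ler_norm_sum _ _ _) _.
apply: (@le_trans _ _ (\sum_(1 <= n < N.+2) (m%:R : R))).
  by apply: ler_sum => n _; exact: class_coef_le.
rewrite sumr_const_nat subSS subn0 -(mulr_natr m%:R) -mulrA ler_wpM2l //.
apply: (@le_trans _ _ (1 + `|A|)); first by have := ler_norm A; lra.
have p1 : 1 <= N.+1%:R `^ Num.max alpha 0.
  by rewrite -[leLHS](powRr0 N.+1%:R) ler_powR // le_max lexx orbT.
by rewrite ler_peMr // addr_ge0.
Qed.

Lemma sum_conjugate_ends (F : nat -> R) m : (2 < m)%N -> F m.-1 = F 1%N ->
  \sum_(1 <= k < m) F k = 2 * F 1%N + \sum_(2 <= k < m.-1) F k.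
Proof.
case: m => [|[|[|m]]] //= _ Fm.
by rewrite big_nat_recr //= big_ltn // Fm; ring.
Qed.

(** Conjugate roots give the same real part: this is why the dominant term of
    the sum over [k] occurs twice. *)
Lemma sifted_last m j (s : R) : (2 < m)%N ->
  sifted ((m - 1)%:R * root_angle m) ((m - 1)%:R * root_angle m * (m - j)%:R)
    s 0 =
  sifted (1%:R * root_angle m) (1%:R * root_angle m * (m - j)%:R) s 0.
Proof.
move=> m2; congr (limn (series _)); apply/funext => n.
by rewrite !twist_angle cos_angleC //; lia.
Qed.

End remainder_bound.

Theorem theorem4p1 (R : realType) (m : nat) (hm : (2 < m)%N)
    (alpha : R) (halpha : alpha < 1) (j : 'I_m) :
  ~ (Omega_rem m j =o_ (pinfty_nbhs R) (fun x : R => x `^ alpha)).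
Proof.
move=> /(class_coef_sum_le (ltn_ord j) halpha)[C [al [C0 al01 hC]]].
have [L [K [K0 hL]]] := bounded_partial_sums_lipschitz al01 C0 hC.
pose phi : R := root_angle m.
have /andP[phi0 phipi] := @root_angle_bounds R m hm.
have sphi : 0 < sin phi by apply: sin_gt0_pi; rewrite phi0.
have cphi : 0 < 1 + cos phi.
  have : cos pi < cos phi by rewrite ltr_cos ?in_itv /= ?pi_ge0 ?lexx ?(ltW
    phi0) ?(ltW phipi).
  by rewrite cospi; lra.
have [d [d0 hd1 hd]] : exists d, [/\ 0 < d, d <= 1 + cos phi &
    forall k, k \in index_iota 2 m.-1 -> d <= cos phi - cos (k%:R * phi)].
  apply: uniform_gap => // k; rewrite mem_index_iota => /andP[k2 km].
  by rewrite subr_gt0; apply: cos_angle_lt; rewrite // -ltn_predRL.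
(* The errors to beat are fewer than [m] series of smaller modulus and
   [K (s - 1)]. *)
pose e : R := (m%:R + K + 1)^-1.
have mK0 : 0 < m%:R + K + 1 by rewrite ltr_wpDl // addr_ge0.
have e0 : 0 < e by rewrite invr_gt0.
have [s0 s01 hdom] := dominance d0 hd1 e0.
pose beta := phi * (m - j)%:R.
(* Near 1 the two conjugate dominant terms decide the sign of the limit [L]. *)
have key (sg s : R) : 1 < s < s0 -> `|sg| = 1 ->
    sg * cos (beta + phase phi s) = 1 -> 0 < sg * L.
  move=> ss sg1 hsg; have /andP[s1 _] := ss.
  have [F0 hs hk] := hdom s ss beta sg _ sg1 (cvg_euler_phase (ltW sphi) s1)
    hsg.
  pose F k := sifted (k%:R * phi) (k%:R * phi * (m - j)%:R) s 0.
  have F1E : F 1%N = sifted phi beta s 0 by rewrite /F mul1r.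
  rewrite -F1E in F0 hs hk.
  have cD : series (fun n => class_coef m j n * npow s n) @ \oo -->
    \sum_(1 <= k < m) F k.
    have -> : (fun n => class_coef m j n * npow s n) =
      (fun n => \sum_(1 <= k < m) (rough 0 n)%:R * twist (k%:R * phi) (k%:R *
        phi * (m - j)%:R) n * npow s n).
      apply/funext => n; rewrite -mulr_suml; congr (_ * _).
      by apply: eq_bigr => k _; rewrite rough0 mul1r.
    by apply: cvg_series_sum => k; exact: cvg_sifted.
  have cDv : cvgn (series (fun n => class_coef m j n * npow s n))
    by apply/cvg_ex; exists (\sum_(1 <= k < m) F k).
  have := hL s s1 cDv.
  have -> : limn (series (fun n => class_coef m j n * npow s n)) =
    \sum_(1 <= k < m) F k.
    exact: cvg_lim cD.
  have -> : \sum_(1 <= k < m) F k = 2 * F 1%N + \sum_(2 <= k < m.-1) F k.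
    by apply: sum_conjugate_ends; rewrite // /F -subn1 sifted_last.
  set S := \sum_(2 <= k < m.-1) F k.
  set X := sg * F 1%N in F0 hs hk *.
  have hS : `|S| <= m%:R * (e * X).
    apply: le_trans (ler_norm_sum _ _ _) _.
    apply: (@le_trans _ _ (\sum_(2 <= k < m.-1) e * X)).
      rewrite big_seq [leRHS]big_seq; apply: ler_sum => k kin.
      by apply: hk; have := hd k kin; lra.
    rewrite sumr_const_nat -[e * X *+ _]mulr_natl ler_wpM2r //; last first.
      by rewrite ler_nat (leq_trans (leq_subr _ _)) // leq_pred.
    by rewrite mulr_ge0 ?ltW.
  move=> hDL.
  have hsS : `|sg * S| <= m%:R * (e * X) by rewrite normrM sg1 mul1r.
  have hsDL : `|sg * (2 * F 1%N + S - L)| <= K * (e * X).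
    rewrite normrM sg1 mul1r; apply: le_trans hDL _; exact: ler_wpM2l.
  have -> : sg * L = 2 * X + sg * S - sg * (2 * F 1%N + S - L) by rewrite /X;
    ring.
  have eX : (m%:R + K + 1) * (e * X) = X
    by rewrite mulrA divff ?mul1r // gt_eqF.
  have eX0 : 0 < e * X by rewrite mulr_gt0.
  move: hsS hsDL; rewrite !ler_norml => /andP[h1 _] /andP[_ h2].
  rewrite !mulrDl mul1r in eX.
  by move: (sg * S) (sg * (_ - L)) (m%:R * _) (K * _) h1 h2 eX =>
    a b c f h1 h2 eX; lra.
have [s ss hs] := phase_hits beta sphi s01.
have Lp : 0 < 1 * L by apply: (key 1 s) => //; rewrite ?normr1 ?mul1r.
(* Half a turn further the dominant terms change sign. *)
have [t tt ht] := phase_hits (beta + pi) sphi s01.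
have Ln : 0 < -1 * L.
  apply: (key (-1) t) => //; first by rewrite normrN1.
  by rewrite mulN1r -cosDpi addrAC.
by lra.
Qed.
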